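(* Let $G$ be a finite group. If there exists $\varphi\in\mathrm{Irr}(G)$ with $d(\varphi)\geq 3$, then $\mathrm{AD}(G)\geq 2+|G'|^{-1}$.
   Context: For a finite group $G$, $G'$ denotes the derived (commutator) subgroup of $G$, $\mathrm{Irr}(G)$ denotes the set of irreducible complex characters of $G$, and $d(\varphi)$ denotes the degree of a character $\varphi$. The Fourier anti-diagonal constant of $G$ is given by the formula $\mathrm{AD}(G)=\frac{1}{|G|}\sum_{\varphi\in\mathrm{Irr}(G)} d(\varphi)^3$ (this is known to equal the Fourier norm of the subset $\{(g,g^{-1}): g\in G\}$ of $G\times G$; the formula may be taken as the definition). *)

(* Defs.v *)
From mathcomp Require Import all_boot all_order all_algebra.
From mathcomp Require Import all_fingroup all_solvable all_field all_character.

Set Implicit Arguments.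
Unset Strict Implicit.
Unset Printing Implicit Defensive.

Import Order.TTheory GRing.Theory Num.Theory.
Local Open Scope ring_scope.

(* The degree of a character is its value at the identity.  Values live in
   [algC], the field over which MathComp develops complex characters; degrees
   are natural numbers there, so the order of [algC] compares them as usual. *)
Definition chardeg (gT : finGroupType) (G : {group gT}) (phi : 'CF(G)) : algC :=
  phi 1%g.

(* The Fourier anti-diagonal constant AD(G). *)
Definition AD (gT : finGroupType) (G : {group gT}) : algC :=
  (#|G|%:R)^-1 * \sum_(i : Iirr G) chardeg 'chi_i ^+ 3.

(* Main.v *)
Require Import Defs.
From mathcomp Require Import all_boot all_order all_algebra.
From mathcomp Require Import all_fingroup all_solvable all_field all_character.
From mathcomp Require Import zify ring.

(** Write L = |G : G'| for the number of linear characters.  Since the squares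
of the degrees add up to |G|, multiplying the inequality by |G| turns it into
sum_chi (d^3 - 2 d^2) >= L, d = chi(1).
Each linear character contributes -1 and degree 2 contributes 0, so the
characters of degree at least 3 have to contribute at least 2 L, and one of
them provides enough others: its twists by linear characters.  The twists of
chi form an orbit of size L / s under the group of linear characters, where s
is the number of linear lambda with lambda chi = chi.  Each such lambda is a
constituent of chi chi^*, so s <= d^2 (lemma [twist_stab_le]), and the orbit
contributes at least L d^2 (d - 2) / s >= L (d - 2), which is enough if d >= 4.

For d = 3 the orbit contributes 9 L / s, which is enough if s <= 4.  Taking
determinants in lambda chi = chi gives lambda^3 = 1, so s is a power of 3
(lemma [card_twist]) and the only remaining case is s = 9 = d^2.  Then chi chi^*
is the sum of the nine stabilising linear characters, so |chi| = 3 on G'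
(lemma [twist_stab_full]) and G' acts by scalars.  If the complex conjugate of
chi were a twist of chi, these scalars would be real; their cubes are values of
the linear character det chi on G', that is 1, so they would all be 1 and chi
would be linear (lemma [odd_conj_twist_lin]).  So the conjugates of the twists
form a second orbit (lemma [twist_orbit_conj_disjoint]), and the two orbits
together contribute 2 L.  The bound is reached by the extraspecial groups of
order 27. *)

Import Order.TTheory GRing.Theory Num.Theory.
Local Open Scope ring_scope.

Definition twist_stab {gT : finGroupType} {G : {group gT}} (i : Iirr G) :
    {set Iirr G} :=
  [set j | ('chi_j \is a linear_char) && ('chi_j * 'chi_i == 'chi_i)].

Definition twist_orbit {gT : finGroupType} {G : {group gT}} (i : Iirr G) :
    {set Iirr G} :=
  [set k | [exists j,
    ('chi_j \is a linear_char) && ('chi_k == 'chi_j * 'chi_i)]].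

(** Compare determinants in lambda chi = chi: twisting by lambda multiplies
det chi by lambda^(chi(1)). *)
Lemma twist_stab_exp {gT : finGroupType} {G : {group gT}} (i j : Iirr G) :
  j \in twist_stab i -> 'chi_j ^+ Num.truncn ('chi_i 1%g) = 1.
Proof.
rewrite inE => /andP[linj /eqP ji].
have := cfDet_mul_lin linj (irr_char i); rewrite ji.
have lind := cfDet_lin_char 'chi_i.
move/(congr1 (fun phi => phi * (cfDet 'chi_i)^*%CF)).
by rewrite -mulrA mul_conjC_lin_char ?mulr1.
Qed.

(** Orbit-stabiliser for the group of linear characters acting on the
irreducible characters by multiplication; the exponent of the stabiliser divides
chi(1), hence so do the primes dividing its order. *)
Lemma card_twist {gT : finGroupType} {G : {group gT}} (i : Iirr G) :
  (#|twist_orbit i| * #|twist_stab i| = #|G : G^`(1)|%g)%N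
  /\ \pi(Num.truncn ('chi_i 1%g)).-nat #|twist_stab i|.
Proof.
have [linG [cF [cFinj <- cFlin cFsurj] [cF1 cFM cFX _ _]]] := lin_char_group G.
pose to (k : Iirr G) u := cfIirr (cF u * 'chi_k).
have toE k u : 'chi_(to k u) = cF u * 'chi_k.
  by rewrite cfIirrE ?mul_lin_irr ?mem_irr.
have to1 : to^~ 1%g =1 id by move=> k; apply: irr_inj; rewrite toE cF1 mul1r.
have toM k : act_morph to k.
  by move=> u v; apply: irr_inj; rewrite !toE cFM mulrCA mulrA.
pose act := TotalAction to1 toM.
pose H := 'C_[set: linG][i | act]%G.
pose h u := cfIirr (cF u).
have hE u : 'chi_(h u) = cF u by rewrite cfIirrE ?lin_char_irr.
have h_inj : injective h.
  by move=> u v /(congr1 (fun j => 'chi_j)); rewrite !hE; apply: cFinj.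
have HE u : (u \in H) = (cF u * 'chi_i == 'chi_i).
  rewrite inE in_setT /=; apply/astab1P/eqP=> [/= iu|ui].
    by rewrite -toE [to _ _]iu.
  by apply: irr_inj; rewrite /= toE.
have stabE : twist_stab i = h @: H.
  apply/setP=> j; rewrite inE; apply/andP/imsetP=> [[linj ji]|[u Hu ->]].
    have [u ju] := cFsurj _ linj; exists u; first by rewrite HE -ju.
    by apply: irr_inj; rewrite hE.
  by rewrite hE -HE Hu cFlin.
have orbE : twist_orbit i = orbit act [set: linG] i.
  apply/setP=> k; rewrite inE.
  apply/existsP/orbitP=> [[j /andP[linj /eqP kj]]|[u _ <-]].
    have [u ju] := cFsurj _ linj; exists u => //.
    by apply: irr_inj; rewrite /= toE kj ju.
  by exists (h u); rewrite hE cFlin toE /=.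
split.
  by rewrite stabE orbE (card_imset _ h_inj) card_orbit_stab cardsT.
have [n chi1] : exists n, 'chi_i 1%g = n.+1%:R.
  have := irr_degree_gt0 (socle_of_Iirr i); rewrite irr1_degree.
  by case: (irr_degree _) => // n _; exists n.
rewrite stabE (card_imset _ h_inj) -[_.-nat _]/(pgroup _ H) -pnat_exponent.
have: (exponent H %| n.+1)%N.
  apply/exponentP=> u Hu; apply: cFinj; rewrite cFX cF1 -hE.
  have: h u \in twist_stab i by rewrite stabE imset_f.
  by move/twist_stab_exp; rewrite chi1 natrK.
by move/pnat_dvd; apply; rewrite chi1 natrK pnat_pi.
Qed.

(** The multiplicity of a linear
lambda in chi chi^* is the inner product of chi with lambda chi, which is 1 when
lambda fixes chi.  So the stabiliser splits off chi chi^*. *)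
Lemma twist_stab_residue {gT : finGroupType} {G : {group gT}} (i : Iirr G) :
  'chi_i * ('chi_i)^*%CF - \sum_(j in twist_stab i) 'chi_j \is a character.
Proof.
apply/forallP=> k; rewrite coord_cfdot cfdotBl cfdot_suml.
have Nk : 'chi_i * ('chi_i)^*%CF \is a character.
  by rewrite rpredM ?cfConjC_char ?irr_char.
have [Sk | notSk] := boolP (k \in twist_stab i).
  rewrite (bigD1 k) //= cfnorm_irr big1 => [|j /andP[_ /negbTE neq]]; last first.
    by rewrite cfdot_irr neq.
  suff ->: '['chi_i * ('chi_i)^*%CF, 'chi_k] = 1 by rewrite addr0 subrr.
  move: Sk; rewrite inE => /andP[_ /eqP Dk]; rewrite -(cfnorm_irr i) -{4}Dk.
  rewrite !cfdotE; congr (_ * _); apply: eq_bigr => x _.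
  by rewrite !cfunE rmorphM /= mulrAC mulrA.
rewrite big1 ?subr0 ?Cnat_cfdot_char_irr // => j Sj.
by rewrite cfdot_irr; case: eqP Sj notSk => // -> ->.
Qed.

Lemma twist_stab_residue_deg {gT : finGroupType} {G : {group gT}} (i : Iirr G) :
  ('chi_i * ('chi_i)^*%CF - \sum_(j in twist_stab i) 'chi_j) 1%g =
  'chi_i 1%g ^+ 2 - #|twist_stab i|%:R.
Proof.
rewrite !cfunE sum_cfunE -normCK ger0_norm ?char1_ge0 ?irr_char //.
congr (_ - _).
rewrite -sumr_const; apply: eq_bigr => j; rewrite inE => /andP[linj _].
exact: lin_char1.
Qed.

Lemma twist_stab_le {gT : finGroupType} {G : {group gT}} (i : Iirr G) :
  #|twist_stab i|%:R <= 'chi_i 1%g ^+ 2.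
Proof.
by rewrite -subr_ge0 -twist_stab_residue_deg char1_ge0 ?twist_stab_residue.
Qed.

(** When the stabiliser is as large as possible, nothing is left of chi chi^*
after splitting it off, so chi chi^* is a sum of linear characters, hence
constant on G'. *)
Lemma twist_stab_full {gT : finGroupType} {G : {group gT}} (i : Iirr G) :
    #|twist_stab i|%:R = 'chi_i 1%g ^+ 2 ->
  G^`(1)%g \subset 'Z('chi_i)%CF.
Proof.
move=> full; apply/subsetP=> x G'x; have Gx := subsetP (der_sub 1 G) x G'x.
have := char1_eq0 (twist_stab_residue i).
rewrite twist_stab_residue_deg full subrr eqxx => /esym/eqP/eqP.
rewrite subr_eq0 => /eqP/(congr1 (fun phi : 'CF(G) => phi x)).
rewrite !cfunE sum_cfunE -normCK.
rewrite (eq_bigr (fun=> 1)) => [|j]; last first.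
  rewrite inE => /andP[linj _].
  by have /subsetP/(_ x G'x)/cfker1-> := lin_char_der1 linj; apply: lin_char1.
rewrite sumr_const full => /eqP.
rewrite eqrXn2 ?normr_ge0 ?char1_ge0 ?irr_char // => norm_x.
by rewrite /cfcenter irr_char inE Gx.
Qed.

(** On G' linear characters are trivial, so a twist of chi agrees with chi
there.  If chi^* is a twist of chi, the scalars mu(x), for x in G', are real of
modulus 1, so mu(x)^2 = 1; the determinant gives mu(x)^n = 1 with n odd. *)
Lemma odd_conj_twist_lin {gT : finGroupType} {G : {group gT}} (i : Iirr G) n :
    'chi_i 1%g = n%:R -> odd n -> G^`(1)%g \subset 'Z('chi_i)%CF ->
  conjC_Iirr i \in twist_orbit i -> 'chi_i \is a linear_char.
Proof.
move=> chi1 oddn sG'Z; rewrite inE => /existsP[j /andP[linj /eqP conj_i]].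
rewrite lin_irr_der1; apply/subsetP=> x G'x.
have Gx := subsetP (der_sub 1 G) x G'x; have Zx := subsetP sG'Z x G'x.
have triv (xi : 'CF(G)) : xi \is a linear_char -> xi x = 1.
  move=> lin_xi; have /subsetP/(_ x G'x)/cfker1-> := lin_char_der1 lin_xi.
  exact: lin_char1.
have [mu lin_mu res_mu] := cfcenter_Res 'chi_i.
have sZG := cfcenter_sub 'chi_i.
have n_neq0 : n%:R != 0 :> algC by rewrite -chi1 irr1_neq0.
have chix : 'chi_i x = n%:R * mu x.
  by rewrite -(cfResE _ sZG Zx) res_mu cfunE chi1.
have mu_n : mu x ^+ n = 1.
  have := cfDetRes (cfcenter_group 'chi_i) (irr_char i).
  rewrite res_mu chi1 scaler_nat cfDetMn ?lin_charW // cfDet_id //.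
  move/(congr1 (fun xi : 'CF('Z('chi_i)%CF) => xi x)).
  rewrite cfResE // triv ?cfDet_lin_char //.
  by rewrite exp_cfunE.
have mu_real : (mu x)^* = mu x.
  have: ('chi_i x)^* = 'chi_i x.
    by rewrite -cfConjCE -conjC_IirrE conj_i cfunE triv ?mul1r.
  by rewrite chix rmorphM /= rmorph_nat => /(mulfI n_neq0).
have mu_sqr : mu x ^+ 2 = 1.
  by rewrite expr2 -{2}mu_real -normCK normC_lin_char ?expr1n.
have mu1 : mu x = 1.
  rewrite -mu_n -(odd_double_half n) oddn -mul2n.
  by rewrite exprD exprM mu_sqr expr1n mulr1.
by rewrite cfkerEchar ?irr_char // inE Gx chix mu1 mulr1 chi1 /=.
Qed.

Lemma twist_orbit1 {gT : finGroupType} {G : {group gT}} (i k : Iirr G) :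
  k \in twist_orbit i -> 'chi_k 1%g = 'chi_i 1%g.
Proof.
rewrite inE => /existsP[j /andP[linj /eqP->]].
by rewrite cfunE lin_char1 ?mul1r.
Qed.

Lemma twist_orbit_conj_disjoint {gT : finGroupType} {G : {group gT}}
    (i : Iirr G) :
    conjC_Iirr i \notin twist_orbit i ->
  [disjoint twist_orbit i & @conjC_Iirr gT G @: twist_orbit i].
Proof.
apply: contraR => /pred0Pn[k /andP[/= + /imsetP[l + kl]]].
rewrite {k}kl !inE => /existsP[j /andP[linj /eqP ej]].
move=> /existsP[m /andP[linm /eqP em]].
have lin_mj : 'chi_m * 'chi_j \is a linear_char by rewrite rpredM.
apply/existsP; exists (cfIirr ('chi_m * 'chi_j)).
rewrite cfIirrE ?lin_char_irr // lin_mj /= -mulrA -ej !conjC_IirrE em rmorphM.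
by rewrite mulrA mul_conjC_lin_char ?mul1r.
Qed.

(** The twist orbit of chi, together with the conjugates of its members in the
exceptional case of degree 3 and stabiliser of order 9. *)
Lemma many_irr_same_degree {gT : finGroupType} {G : {group gT}} (i : Iirr G) :
    3 <= 'chi_i 1%g ->
  exists2 T : {set Iirr G}, {in T, forall k, 'chi_k 1%g = 'chi_i 1%g}
    & 2 * #|G : G^`(1)|%g%:R <=
      #|T|%:R * ('chi_i 1%g ^+ 3 - 2 * 'chi_i 1%g ^+ 2).
Proof.
have [LE pis] := card_twist i.
have [n chi1] : exists n, 'chi_i 1%g = n%:R.
  by exists (irr_degree (socle_of_Iirr i)); rewrite irr1_degree.
have s_le : (#|twist_stab i| <= n ^ 2)%N.
  by have := twist_stab_le i; rewrite chi1 -natrX ler_nat.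
rewrite -LE chi1 (ler_nat _ 3) => n_ge3.
(* As L = |orbit| s, this makes the twist orbit contribute at least L (n - 2). *)
have f_ge :
    #|twist_stab i|%:R * (n%:R - 2) <= n%:R ^+ 3 - 2 * n%:R ^+ 2 :> algC.
  rewrite [n%:R ^+ 3]exprSr -[2 * _]mulrC -mulrBr -natrX ler_wpM2r ?ler_nat //.
  by rewrite subr_ge0 ler_nat ltnW.
have [n3 | n_neq3] := eqVneq n 3%N; last first.
  exists (twist_orbit i) => [k /twist_orbit1-> //|].
  rewrite natrM mulrCA ler_wpM2l // (le_trans _ f_ge) //.
  rewrite [2 * _]mulrC ler_wpM2l //.
  by rewrite lerBrDr -natrD ler_nat ltn_neqAle eq_sym n_neq3.
have {}pis : 3%N.-nat #|twist_stab i|.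
  by move: pis; rewrite chi1 n3 natrK (eq_pnat _ (pi_of_prime _)).
have f3 : n%:R ^+ 3 - 2 * n%:R ^+ 2 = 9 :> algC by rewrite n3; ring.
have [k sk] := p_natP pis.
have [s_le3 | s_gt3] := leqP #|twist_stab i| 3%N.
  exists (twist_orbit i) => [l /twist_orbit1-> //|].
  rewrite natrM mulrCA ler_wpM2l // f3. rewrite -(natrM _ 2) (ler_nat _ _ 9).
  exact: leq_trans (leq_mul (leqnn 2) s_le3) _.
(* The powers of 3 strictly above 3 and at most n^2 = 9. *)
have s9 : #|twist_stab i| = 9%N.
  move: s_gt3 s_le; rewrite sk n3; case: k {sk} => [|[|[|k]]] // _.
  by rewrite !expnS; have := expn_gt0 3 k; case: (3 ^ k)%N => // m _; lia.
have nconj : conjC_Iirr i \notin twist_orbit i.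
  apply/negP=> conj_i.
  have sG'Z : G^`(1)%g \subset 'Z('chi_i)%CF.
    by apply: twist_stab_full; rewrite s9 chi1 n3 -natrX.
  have := @odd_conj_twist_lin _ _ i n chi1; rewrite n3 => /(_ isT sG'Z conj_i).
  by move/lin_char1/eqP; rewrite chi1 n3 pnatr_eq1.
exists (twist_orbit i :|: @conjC_Iirr gT G @: twist_orbit i) => [l|].
  rewrite in_setU => /orP[/twist_orbit1-> //|/imsetP[m /twist_orbit1 m1 ->]].
  by rewrite conjC_IirrE cfConjC_char1 ?irr_char // m1.
rewrite cardsU disjoint_setI0 ?twist_orbit_conj_disjoint // cards0 subn0.
rewrite (card_imset _ (can_inj conjC_IirrK)) s9 addnn -muln2.
by rewrite f3 !natrM mulrA [2 * _]mulrC lexx.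
Qed.

Theorem proposition1p4 (gT : finGroupType) (G : {group gT})
    (hG : exists2 phi : 'CF(G), phi \in irr G & 3 <= chardeg phi) :
  2 + (#|G^`(1)%g|%:R)^-1 <= AD G.
Proof.
have [_ /irrP[i ->]] := hG; rewrite /chardeg => chi_ge3.
have [T degT cardT] := many_irr_same_degree i chi_ge3.
pose f (k : Iirr G) : algC := 'chi_k 1%g ^+ 3 - 2 * 'chi_k 1%g ^+ 2.
have idxE : #|G : G^`(1)|%g%:R = #|G|%:R * (#|G^`(1)%g|%:R)^-1 :> algC.
  by rewrite -(Lagrange (der_sub 1 G)) natrM mulrAC divff ?mul1r ?neq0CG.
have G_gt0 : 0 < #|G|%:R :> algC by rewrite ltr0n cardG_gt0.
rewrite /AD /chardeg mulrC ler_pdivlMr // mulrC mulrDr -idxE mulrC.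
rewrite -(irr_sum_square G) mulr_sumr -lerBrDl -sumrB -/f.
pose lin := [pred k : Iirr G | 'chi_k \is a linear_char].
have linT k : k \in T -> ~~ lin k.
  move/degT=> k1; apply/negP=> /= /lin_char1; rewrite k1 => i1.
  by move: chi_ge3; rewrite i1 (ler_nat _ 3 1).
(* Every linear character contributes 1 - 2 = -1. *)
rewrite (bigID lin) /= (eq_bigr (fun=> -1)) => [|k link]; last first.
  by rewrite lin_char1 // !expr1n; ring.
rewrite sumr_const card_lin_irr (bigID (mem T)) /=.
rewrite (eq_bigl (mem T)) => [|k]; last first.
  by rewrite andbC; case Tk: (k \in T); rewrite //= linT.
rewrite (eq_bigr (fun=> f i)) => [|k Tk]; last by rewrite /f degT.
rewrite sumr_const mulNrn addrC lerBrDr -mulr2n.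
rewrite -[X in X <= _]mulr_natl -[f i *+ _]mulr_natl.
(* Outside T a nonlinear character of degree d contributes d^2 (d - 2) >= 0. *)
rewrite -[leLHS]addr0 lerD // sumr_ge0 // => k /andP[nlink _].
rewrite -[2 * _]mulrC exprSr -mulrBr.
rewrite mulr_ge0 ?exprn_ge0 ?char1_ge0 ?irr_char //.
move: nlink; rewrite qualifE /= irr_char /= irr1_degree.
rewrite pnatr_eq1 subr_ge0 ler_nat.
by have := irr_degree_gt0 (socle_of_Iirr k); case: (irr_degree _) => [|[]].
Qed.
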